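(* Consider an SJR model whose switching variables are $\mathrm{Ber}(\alpha)$, and let $\xi^*=(1-\alpha,\alpha)$. Let $\xi_1>\cdots>\xi_n>\xi^*$ be directions in $\mathscr U$, and let $(B^{\xi_1},\dots,B^{\xi_n})$ be the corresponding (south-west) Busemann processes of the SJR model. Let $(B_0^{\xi_1},\dots,B_0^{\xi_n})$ be the Busemann processes for the SWFPP model whose horizontal weights are identical to those of the SJR model, $W(x;1)=S(x)\widetilde W(x;1)$, and whose vertical weights are all zero. Then $(B^{\xi_1},\dots,B^{\xi_n})\overset{d}{=}(B_0^{\xi_1},\dots,B_0^{\xi_n})$ as processes indexed by pairs $(x,y)\in(\mathbb{Z}^2)^2$.
   Context: Directed edge-weight FPP on $\mathbb{Z}^2$: weight $W(x;1)$ on edge $(x-e_1,x)$, $W(x;2)$ on edge $(x-e_2,x)$; $L(x,y)$ is the minimal weight sum over up-right paths from $x$ to $y$. SJR model: i.i.d. switching variables $S(x)\sim\mathrm{Ber}(\alpha)$, independent of i.i.d. pairs $(\widetilde W(x;1),\widetilde W(x;2))$ of non-negative, non-constant weights with finite $2+\epsilon$ moments; set $W(x;1)=S(x)\widetilde W(x;1)$ and $W(x;2)=(1-S(x))\widetilde W(x;2)$. SWFPP: all vertical weights zero, horizontal weights non-negative. Directions $\mathscr U=\{(t,1-t):0<t<1\}$, ordered by first coordinate ($\xi>\zeta$ iff $\xi\cdot e_1>\zeta\cdot e_1$). South-west Busemann function in direction $\xi$: $B^\xi(x,y)=\lim_n(L(v_n,x)-L(v_n,y))$ along $|v_n|\to\infty$,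 $v_n/|v_n|\to-\xi$ (existing a.s. for fixed $\xi$). *)

(* Defs.v *)
From HB Require Import structures.
From mathcomp Require Import all_boot all_order all_algebra.
From mathcomp Require Import all_classical all_reals all_analysis.
Set Implicit Arguments. Unset Strict Implicit. Unset Printing Implicit Defensive.
Import Order.TTheory GRing.Theory Num.Theory.
Import numFieldNormedType.Exports.
Local Open Scope classical_set_scope.
Local Open Scope ring_scope.

Definition site := (int * int)%type.

Definition step (x : site) (b : bool) : site :=
  if b then (x.1 + 1, x.2) else (x.1, x.2 + 1).

Fixpoint pend (x : site) (s : seq bool) : site :=
  if s is b :: s' then pend (step x b) s' else x.

(* Weight of an up-right path: W z b is the weight of the edge entering z
   in direction b, i.e. W z true = W(z;1) on edge (z-e1,z),
   W z false = W(z;2) on edge (z-e2,z). *)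
Fixpoint pweight {R : realType} (W : site -> bool -> R) (x : site) (s : seq bool) : R :=
  if s is b :: s' then W (step x b) b + pweight W (step x b) s' else 0.

(* Last-passage-type (minimal, FPP) value L(x,y): minimal weight over up-right
   paths from x to y (a finite nonempty set when x <= y coordinatewise). *)
Definition Lfpp {R : realType} (W : site -> bool -> R) (x y : site) : R :=
  inf [set r | exists s, pend x s = y /\ r = pweight W x s].

Definition l1 {R : realType} (v : site) : R := (`|v.1| + `|v.2|)%:~R.

(* B is (a version of) the south-west Busemann process in direction
   xi = (t, 1-t) for the random passage times L : T -> site -> site -> R:
   almost surely, for all x, y and every sequence v_n with |v_n| -> oo and
   v_n/|v_n| -> -xi, L(v_n,x) - L(v_n,y) -> B(x,y). *)
Definition IsBusemann {d : measure_display} {T : measurableType d} {R : realType}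
  (P : probability T R) (L : T -> site -> site -> R) (t : R)
  (B : site -> site -> T -> R) : Prop :=
  {ae P, forall w, forall (x y : site) (v : nat -> site),
      (fun m => l1 (v m) : R) @ \oo --> +oo ->
      (fun m => ((v m).1)%:~R / l1 (v m) : R) @ \oo --> - t ->
      (fun m => ((v m).2)%:~R / l1 (v m) : R) @ \oo --> - (1 - t) ->
      (fun m => L w (v m) x - L w (v m) y) @ \oo --> B x y w}.

Definition sjr_weight {T : Type} {R : realType} (S : site -> T -> R)
  (Wt : site -> bool -> T -> R) (w : T) : site -> bool -> R :=
  fun z b => if b then S z w * Wt z true w else (1 - S z w) * Wt z false w.

Definition swfpp_weight {T : Type} {R : realType} (S : site -> T -> R)
  (Wt : site -> bool -> T -> R) (w : T) : site -> bool -> R :=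
  fun z b => if b then S z w * Wt z true w else 0.

Definition SJR_assumptions {d : measure_display} {T : measurableType d}
  {R : realType} (P : probability T R) (alpha : R)
  (S : site -> T -> R) (Wt : site -> bool -> T -> R) : Prop :=
  [/\ 0 <= alpha <= 1,
      (forall x, measurable_fun setT (S x)) /\
      (forall x b, measurable_fun setT (Wt x b)),
      (forall x w, S x w = 0 \/ S x w = 1) /\
      (forall x, P [set w | S x w = 1] = alpha%:E) /\
      (forall x y (C D : set R), measurable C -> measurable D ->
         P [set w | C (Wt x true w) /\ D (Wt x false w)] =
         P [set w | C (Wt y true w) /\ D (Wt y false w)]),
      [/\ (forall x b w, 0 <= Wt x b w),
          (forall x b (c : R), P [set w | Wt x b w = c] <> 1%E) &
          (exists2 eps : R, 0 < eps &
             forall x b, (\int[P]_w ((`|Wt x b w| `^ (2 + eps))%:E) < +oo)%E)] &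
      (forall (F : seq site) (A C D : site -> set R), uniq F ->
         (forall x, [/\ measurable (A x), measurable (C x) & measurable (D x)]) ->
         P (\bigcap_(x in [set x | x \in F])
              [set w | [/\ A x (S x w), C x (Wt x true w) & D x (Wt x false w)]])
         = (\prod_(x <- F) (P [set w | A x (S x w)] *
                             P [set w | C x (Wt x true w) /\ D x (Wt x false w)]))%E)].

(* Main.v *)
Require Import Defs.
From HB Require Import structures.
From mathcomp Require Import all_boot all_order all_algebra.
From mathcomp Require Import all_classical all_reals all_analysis.
From mathcomp Require Import zify ring lra.
Import Order.TTheory GRing.Theory Num.Theory.
Import numFieldNormedType.Exports.
Local Open Scope classical_set_scope.
Local Open Scope ring_scope.
Set Implicit Arguments.
Unset Strict Implicit.
Unset Printing Implicit Defensive.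

(* From every site [z] of the SJR model a free path runs backwards: left if
   [S z = 0], down if [S z = 1]. It costs nothing in the SWFPP model either and
   has asymptotic direction [xi^*], so it eventually passes below every line of
   direction [xi > xi^*].

   Write [L] and [L0 <= L] for the passage times of the two models. If [v] is
   the highest site of its column with a given value of [L0 v x], then
   [L v x = L0 v x]: along an [L0]-geodesic from [v] to [x], an upward step into
   a site [z] with [S z = 0] can be bypassed, because the free path from [z]
   cannot enter the column of [v] above [v] and hence meets the geodesic.
   Starting from a near-minimiser of [L0 _ x] on a strip around the ray of
   direction [-xi], lifting it to such a [v] and following the free path from
   [v] back to the strip gives sites [u] of direction [-xi] with
   [L u x <= L0 u x + o(1)]. Along these [u] one reads off
   [B x y <= B0 x y], and with the roles of [x] and [y] exchanged the converse.
   Thus the two Busemann processes are even almost surely equal. *)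

(** * Up-right paths and their minimal weights *)

Section Paths.
Variable R : realType.
Implicit Types (x y z u v : site) (s : seq bool) (W : site -> bool -> R).

Lemma pend_cat x s1 s2 : pend x (s1 ++ s2) = pend (pend x s1) s2.
Proof. by elim: s1 x => //= b s1 IH x; rewrite IH. Qed.

Lemma pweight_cat W x s1 s2 :
  pweight W x (s1 ++ s2) = pweight W x s1 + pweight W (pend x s1) s2.
Proof. by elim: s1 x => [|b s1 IH] x /=; rewrite ?add0r // IH addrA. Qed.

Lemma pendE x s :
  pend x s = (x.1 + (count id s)%:Z, x.2 + (count negb s)%:Z).
Proof.
elim: s x => [|b s IH] [x1 x2] /=; first by rewrite !addr0.
by rewrite IH; case: b => /=; congr pair; lia.
Qed.

Lemma pend_exists x y : x.1 <= y.1 -> x.2 <= y.2 -> exists s, pend x s = y.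
Proof.
move=> h1 h2.
exists (nseq `|y.1 - x.1|%N true ++ nseq `|y.2 - x.2|%N false).
rewrite pendE !count_cat !count_nseq /=; case: y h1 h2 => y1 y2 /= h1 h2.
by congr pair; lia.
Qed.

Lemma pweight_ge0 W x s : (forall z b, 0 <= W z b) -> 0 <= pweight W x s.
Proof. by move=> W0; elim: s x => //= b s IH x; rewrite addr_ge0. Qed.

Lemma ler_pweight W W' x s :
  (forall z b, W z b <= W' z b) -> pweight W x s <= pweight W' x s.
Proof. by move=> le; elim: s x => //= b s IH x; rewrite lerD. Qed.

Lemma Lfpp_le W x s :
  (forall z b, 0 <= W z b) -> Lfpp W x (pend x s) <= pweight W x s.
Proof.
move=> W0; apply: ge_inf; last by exists s.
by exists 0 => _ [s' [_ ->]]; exact: pweight_ge0.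
Qed.

(** All up-right paths between two sites have the same length, so the infimum is over finitely many
    values. *)
Lemma Lfpp_attained W x y : x.1 <= y.1 -> x.2 <= y.2 ->
  (forall z b, 0 <= W z b) ->
  exists2 s, pend x s = y & Lfpp W x y = pweight W x s.
Proof.
move=> h1 h2 W0; have [s0 ps0] := pend_exists h1 h2.
pose Q (s : (size s0).-tuple bool) := pend x s == y.
have Q0 : Q (in_tuple s0) by apply/eqP.
case: (arg_minP (fun s : (size s0).-tuple bool => pweight W x s) Q0)
  => s /eqP ps smin.
exists s => //; apply/eqP; rewrite eq_le; apply/andP; split.
  by rewrite -ps; exact: Lfpp_le.
apply: lb_le_inf; first by exists (pweight W x s0), s0.
move=> _ [s' [ps' ->]].
have sz : size s' == size s0.
  have szE s1 : size s1 = (count id s1 + count negb s1)%N.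
    by rewrite -(count_predC id).
  by move: ps' ps0; rewrite !szE !pendE => <- [e1 e2]; lia.
by have := smin (Tuple sz); apply; apply/eqP.
Qed.

Lemma Lfpp_ge0 W x y : (forall z b, 0 <= W z b) -> 0 <= Lfpp W x y.
Proof.
move=> W0; rewrite /Lfpp; set E := (E in inf E).
have [->|E0] := eqVneq E set0; first by rewrite inf0.
apply: lb_le_inf; first exact/set0P.
by move=> _ [s [_ ->]]; exact: pweight_ge0.
Qed.

Lemma ler_Lfpp W W' x y : (forall z b, 0 <= W z b) ->
  (forall z b, W z b <= W' z b) -> Lfpp W x y <= Lfpp W' x y.
Proof.
move=> W0 le; have [[s ps]|nops] := pselect (exists s, pend x s = y).
  apply: lb_le_inf; first by exists (pweight W' x s), s.
  move=> _ [s' [ps' ->]]; apply: le_trans (ler_pweight _ _ le).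
  by rewrite -ps'; exact: Lfpp_le.
(* Without a path from [x] to [y] both infima are over the empty set and take the same default
   value. *)
have nil W1 : [set r | exists s, pend x s = y /\ r = pweight W1 x s] = set0.
  by rewrite -subset0 => r [s [ps _]]; apply: nops; exists s.
by rewrite /Lfpp !nil.
Qed.

Lemma Lfpp_triangle W x s y : (forall z b, 0 <= W z b) ->
  (pend x s).1 <= y.1 -> (pend x s).2 <= y.2 ->
  Lfpp W x y <= pweight W x s + Lfpp W (pend x s) y.
Proof.
move=> W0 h1 h2; have [s' ps' ->] := Lfpp_attained h1 h2 W0.
by rewrite -pweight_cat -{1}ps' -pend_cat; exact: Lfpp_le.
Qed.

End Paths.

(** * Backward walks along free edges *)

Definition back (h : site -> bool) (z : site) : site :=
  if h z then (z.1 - 1, z.2) else (z.1, z.2 - 1).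

Definition bwalk (h : site -> bool) (z : site) (k : nat) : site :=
  iter k (back h) z.

Section BackwardWalk.
Variable h : site -> bool.
Implicit Types (z v : site).

Lemma step_back z : step (back h z) (h z) = z.
Proof.
by case: z => a b; rewrite /step /back; case: (h (a, b)) => /=; rewrite subrK.
Qed.

Lemma bwalkS z k : bwalk h z k.+1 = back h (bwalk h z k).
Proof. by []. Qed.

Lemma bwalkSr z k : bwalk h z k.+1 = bwalk h (back h z) k.
Proof. exact: iterSr. Qed.

Lemma bwalk_le z k : (bwalk h z k).1 <= z.1 /\ (bwalk h z k).2 <= z.2.
Proof.
elim: k => [|k [IH1 IH2]]; first by [].
by rewrite bwalkS /back; case: ifP => _ /=; lia.
Qed.

Lemma bwalk_free_path (R : realType) (W : site -> bool -> R) z k :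
  (forall z, W z (h z) = 0) ->
  exists2 s, pend (bwalk h z k) s = z & pweight W (bwalk h z k) s = 0.
Proof.
move=> W0; elim: k => [|k [s ps ws]]; first by exists [::].
by exists (h (bwalk h z k) :: s); rewrite /= step_back // W0 add0r.
Qed.

(** The walk moves left by at most one column per step and never rises. *)
Lemma bwalk_column z v k : v.1 <= z.1 -> (bwalk h z k).1 < v.1 ->
  exists2 j, (bwalk h z j).1 = v.1 & (bwalk h z k).2 <= (bwalk h z j).2.
Proof.
move=> vz; elim: k => [|k IH]; first by rewrite /bwalk /=; lia.
rewrite bwalkS {1 2}/back; case: ifP => _ /= lt.
  have [e|ne] := eqVneq (bwalk h z k).1 v.1; first by exists k.
  by apply: IH; lia.
by have [j e1 e2] := IH lt; exists j => //; lia.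
Qed.

(* Both curves are followed down the antidiagonals, where they cannot jump
   over each other. *)
Lemma bwalk_cross v s z :
  z.1 + z.2 = (pend v s).1 + (pend v s).2 -> z.1 < (pend v s).1 ->
  (exists k p r, s = p ++ r /\ bwalk h z k = pend v p) \/
  (exists k, (bwalk h z k).1 < v.1 /\ v.2 < (bwalk h z k).2).
Proof.
elim/last_ind: s z => [|s b IH] z /=; first by move=> e lt; right; exists 0%N => /=; lia.
rewrite -cats1 pend_cat /=; set u := pend v s => e lt.
have [eq|ne] := eqVneq (back h z) u.
  by left; exists 1%N, s, [:: b].
have [||[k [p [r [-> pk]]]]|[k hk]] := IH (back h z).
- by move: e; rewrite -/u /step /back; case: b lt => /=; case: (h z) => /=; lia.
(* A backward step lowers the first coordinate by 0 or 1, so the strict order persists unless the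
   two sites coincide. *)
- move: e lt ne; rewrite -/u /step /back.
  case: (u) => u1 u2; case: (z) => z1 z2.
  by case: b => /=; case: (h _) => /= e lt;
    rewrite xpair_eqE negb_and => /orP[] /eqP; lia.
- by left; exists k.+1, p, (r ++ [:: b]); rewrite bwalkSr catA.
- by right; exists k.+1; rewrite bwalkSr.
Qed.

End BackwardWalk.

(** * Comparison of the two passage times *)

Section Comparison.
Variables (R : realType) (W W0 : site -> bool -> R) (h : site -> bool).
Hypothesis W_ge0 : forall z b, 0 <= W z b.
Hypothesis W_free : forall z, W z (h z) = 0.
Hypothesis W0_hor : forall z, W0 z true = W z true.
Hypothesis W0_ver : forall z, W0 z false = 0.

Let W0_ge0 z b : 0 <= W0 z b.
Proof. by case: b; rewrite ?W0_hor ?W0_ver. Qed.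

Let W0_le z b : W0 z b <= W z b.
Proof. by case: b; rewrite ?W0_hor ?W0_ver. Qed.

Let W0_free z : W0 z (h z) = 0.
Proof. by apply/eqP; rewrite eq_le W0_ge0 andbT -(W_free z) W0_le. Qed.

(** Strong induction on the length of [s], an initial piece of a [W0]-geodesic to [x]. Prefixes are
    needed because a detour rejoins the geodesic at an earlier site. *)
Lemma top_prefix (v x : site) s :
  (pend v s).1 <= x.1 -> (pend v s).2 <= x.2 ->
  (forall y : site, y.1 = v.1 -> v.2 < y.2 <= x.2 ->
     Lfpp W0 v x < Lfpp W0 y x) ->
  pweight W0 v s + Lfpp W0 (pend v s) x <= Lfpp W0 v x ->
  Lfpp W v (pend v s) <= pweight W0 v s.
Proof.
move=> + + top; have [n] := ubnP (size s).
elim: n s => // n IH s /ltnSE; case/lastP: s => [|s b] szs.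
  move=> _ _ _ /=; rewrite -[X in _ <= X]/(pweight W v [::]).
  exact: (Lfpp_le v [::] W_ge0).
have pw W' : pweight W' v (rcons s b) =
    pweight W' v s + W' (pend v (rcons s b)) b.
  by rewrite -cats1 pweight_cat pend_cat /= addr0.
have pstep : pend v (rcons s b) = step (pend v s) b by rewrite -cats1 pend_cat.
have szs1 : (size s < n)%N by move: szs; rewrite size_rcons.
set z := pend v (rcons s b) => z1 z2 geo.
have [vz1 vz2] : v.1 <= z.1 /\ v.2 <= z.2 by rewrite /z pendE /=; lia.
have back_le : (pend v s).1 <= z.1 /\ (pend v s).2 <= z.2.
  by rewrite /z pstep /step; case: (b) => /=; lia.
have same : W0 z b = W z b -> Lfpp W v z <= pweight W0 v (rcons s b).
  move=> eqW; rewrite pw -/z eqW.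
  have zE : z = pend (pend v s) [:: b] by rewrite /z pstep.
  have [t pt Lt] := Lfpp_attained (y := pend v s) (x := v)
    ltac:(by rewrite pendE /=; lia) ltac:(by rewrite pendE /=; lia) W_ge0.
  have := IH s szs1 ltac:(lia) ltac:(lia).
  have tri := @Lfpp_triangle _ W0 (pend v s) [:: b] x W0_ge0.
  move: tri; rewrite -zE /= addr0 -pstep -/z => /(_ z1 z2) tri.
  move: geo; rewrite pw -/z => geo.
  move=> /(_ ltac:(lra)) le.
  have := Lfpp_le v (rcons t b) W_ge0.
  by rewrite -cats1 pend_cat pweight_cat pt -zE -Lt /= addr0 -pstep -/z; lra.
(* Only an upward step into a site with [h z] true can cost more in [W] than in [W0]. *)
case hz : (h z); last first.
  apply: same; case: (b) => //=; rewrite W0_ver; have := W_free z.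
  by rewrite hz.
case: (b) pw pstep @z z1 z2 geo vz1 vz2 back_le same hz
  => pw pstep z z1 z2 geo vz1 vz2 back_le same hz.
  exact: same.
have zs : z = step (pend v s) false by [].
(* The walk from [z] leaves to the left, above the path: it either meets the
   path again or enters the column of [v] strictly above [v]; the latter is
   excluded by maximality of [v]. *)
have bz : back h z = (z.1 - 1, z.2) by rewrite /back hz.
have [||[k [p [r [sE pk]]]]|[k [k1 k2]]] := @bwalk_cross h v s (back h z).
- by rewrite bz zs /=; lia.
- by rewrite bz zs /=; lia.
- rewrite -bwalkSr in pk.
  have [c1 c2] := bwalk_le h z k.+1.
  have [f pf wf] := bwalk_free_path z k.+1 W_free.
  have [f0 pf0 wf0] := bwalk_free_path z k.+1 W0_free.
  have szp : (size p < n)%N by apply: leq_ltn_trans szs1; rewrite sE size_cat leq_addr.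
  have wps : pweight W0 v p <= pweight W0 v (rcons s false).
    by rewrite pw W0_ver addr0 sE pweight_cat lerDl pweight_ge0.
  (* [p] is still an initial piece of a geodesic, since its end reaches [z] at no [W0] cost. *)
  have := @Lfpp_triangle _ W0 (bwalk h z k.+1) f0 x W0_ge0.
  rewrite pf0 wf0 pk add0r => /(_ z1 z2) le0.
  have := IH p szp; rewrite -pk => /(_ ltac:(lia) ltac:(lia)).
  rewrite pk => /(_ ltac:(lra)) le1.
  have [g pg Lg] := Lfpp_attained (y := pend v p) (x := v)
    ltac:(by rewrite pendE /=; lia) ltac:(by rewrite pendE /=; lia) W_ge0.
  have := Lfpp_le v (g ++ f) W_ge0.
  by rewrite pend_cat pweight_cat pg -pk pf wf addr0 -Lg; lra.
- rewrite -bwalkSr in k1 k2.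
  have [j j1 j2] := bwalk_column vz1 k1.
  have [c1 c2] := bwalk_le h z j.
  have := top (bwalk h z j) j1 ltac:(lia).
  have [f0 pf0 wf0] := bwalk_free_path z j W0_free.
  have := @Lfpp_triangle _ W0 (bwalk h z j) f0 x W0_ge0.
  rewrite pf0 wf0 => /(_ z1 z2).
  by have := pweight_ge0 v (rcons s false) W0_ge0; lra.
Qed.

Lemma Lfpp_eq_top (v x : site) : v.1 <= x.1 -> v.2 <= x.2 ->
  (forall y : site, y.1 = v.1 -> v.2 < y.2 <= x.2 ->
     Lfpp W0 v x < Lfpp W0 y x) ->
  Lfpp W v x <= Lfpp W0 v x.
Proof.
move=> v1 v2 top; have [s ps Ls] := Lfpp_attained v1 v2 W0_ge0.
rewrite -{1}ps Ls; apply: top_prefix; rewrite ?ps // -Ls.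
by rewrite gerDl; have := Lfpp_le x [::] W0_ge0.
Qed.

(** Take the highest site of the column, up to the height of [x], whose [W0] value does not exceed
    that of [v]. *)
Lemma top_exists (v x : site) : v.1 <= x.1 -> v.2 <= x.2 ->
  exists u : site, [/\ u.1 = v.1, v.2 <= u.2 <= x.2,
    Lfpp W0 u x <= Lfpp W0 v x & Lfpp W u x <= Lfpp W0 u x].
Proof.
move=> v1 v2.
pose Q (j : nat) := (v.2 + j%:Z <= x.2) &&
  (Lfpp W0 (v.1, v.2 + j%:Z) x <= Lfpp W0 v x).
have Q0 : exists j, Q j.
  by exists 0%N; rewrite /Q addr0 v2 -surjective_pairing lexx.
have Qb j : Q j -> (j <= `|x.2 - v.2|)%N by move=> /andP[]; lia.
case: (ex_maxnP Q0 Qb) => j /andP[j1 j2] jmax.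
exists (v.1, v.2 + j%:Z); split => //=; first by lia.
apply: Lfpp_eq_top => //= y y1 /andP[y2 y3].
apply: contrapT => /negP; rewrite -leNgt => le.
have := jmax `|y.2 - v.2|%N.
suff -> : Q `|y.2 - v.2|%N by move=> /(_ isT); lia.
have e : v.2 + `|y.2 - v.2|%N%:Z = y.2 by lia.
rewrite /Q e y3 -y1 -surjective_pairing; exact: le_trans j2.
Qed.

End Comparison.

(** * Sites near the ray of direction [(-t, -(1 - t))] *)

Definition drift (R : realType) (t : R) (z : site) : R :=
  t * z.2%:~R - (1 - t) * z.1%:~R.

Lemma drift_back (R : realType) (t : R) h z :
  drift t (back h z) = drift t z + ((h z)%:R - t).
Proof. by rewrite /drift /back; case: (h z) => /=; rewrite intrB /=; lra. Qed.

Section Direction.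
Variables (R : realType) (t : R).
Hypothesis t01 : 0 < t < 1.

(** In the strip each coordinate differs from [- t * l1] or [- (1 - t) * l1] by the drift, which is
    at most one, while [l1] grows at least linearly. *)
Lemma strip_direction (v : nat -> site) :
  (forall m, 0 <= drift t (v m) <= 1) ->
  (forall m, (v m).1 <= - m.+1%:Z) -> (forall m, (v m).2 <= 0) ->
  [/\ (fun m => l1 (v m) : R) @ \oo --> +oo,
      (fun m => ((v m).1)%:~R / l1 (v m) : R) @ \oo --> - t &
      (fun m => ((v m).2)%:~R / l1 (v m) : R) @ \oo --> - (1 - t)].
Proof.
move=> vd v1 v2.
have lE m : l1 (v m) = - (v m).1%:~R - (v m).2%:~R :> R.
  by rewrite /l1 -intrN -intrB; congr (_ %:~R); move: (v1 m) (v2 m); lia.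
have l_ge m : m.+1%:R <= l1 (v m) :> R.
  rewrite lE -[m.+1%:R]/(m.+1%:Z%:~R) -intrN -intrB ler_int.
  by move: (v1 m) (v2 m); lia.
have l_gt0 m : 0 < l1 (v m) :> R by apply: lt_le_trans (l_ge m); rewrite ltr0n.
have ratio1 m : (v m).1%:~R / l1 (v m) = - t - drift t (v m) / l1 (v m) :> R.
  by move: (l_gt0 m); rewrite /drift lE => l0; field; rewrite lt0r_neq0.
have ratio2 m :
    (v m).2%:~R / l1 (v m) = - (1 - t) + drift t (v m) / l1 (v m) :> R.
  by move: (l_gt0 m); rewrite /drift lE => l0; field; rewrite lt0r_neq0.
have small : (fun m => drift t (v m) / l1 (v m)) @ \oo --> (0 : R).
  apply: (@squeeze_cvgr _ _ _ _ (fun=> 0) (@harmonic R)); last 2 first.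
  - exact: cvg_cst.
  - exact: cvg_harmonic.
  apply: nearW => m; have /andP[d0 d1] := vd m.
  rewrite (divr_ge0 d0 (ltW (l_gt0 m))) /= ler_pdivrMr // /harmonic /=.
  apply: le_trans d1 _; rewrite mulrC ler_pdivlMr ?ltr0n //.
  by rewrite mul1r.
split.
- apply: ger_cvgy (@cvgr_idn R); apply: nearW => m.
  by apply: le_trans (l_ge m); rewrite ler_nat.
- rewrite (funext ratio1) -[X in _ --> X]subr0.
  by apply: cvgB small; exact: cvg_cst.
- rewrite (funext ratio2) -[X in _ --> X]addr0.
  by apply: cvgD small; exact: cvg_cst.
Qed.

Variables (W W0 : site -> bool -> R) (h : site -> bool).
Hypothesis W_ge0 : forall z b, 0 <= W z b.
Hypothesis W_free : forall z, W z (h z) = 0.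
Hypothesis W0_hor : forall z, W0 z true = W z true.
Hypothesis W0_ver : forall z, W0 z false = 0.
Hypothesis cross : forall z, exists k, drift t (bwalk h z k) < 0.

(** The infimum over the whole strip also bounds the value at [u], which is found only later as the
    last site before the drift of the free walk first becomes negative. The conditions on [N] put
    the strip south-west of [x]. *)
Lemma strip_point (x : site) (N : nat) (e : R) : 0 < e ->
  - N%:Z <= x.1 -> 1 - (1 - t) * N%:R <= t * x.2%:~R ->
  exists u : site, [/\ 0 <= drift t u <= 1, u.1 <= - N%:Z &
    Lfpp W u x <= Lfpp W0 u x + e].
Proof.
move=> e0 Nx1 Nx2; have /andP[t0 t1] := t01.
have W0_ge0 z b : 0 <= W0 z b by case: b; rewrite ?W0_hor ?W0_ver.
pose strip := [set u : site | 0 <= drift t u <= 1 /\ u.1 <= - N%:Z].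
have strip_le u : strip u -> u.1 <= x.1 /\ u.2 <= x.2.
  move=> [/andP[_ d1] u1]; split; first by lia.
  rewrite -(ler_int R) -(ler_pM2l t0); apply: le_trans Nx2.
  have : u.1%:~R <= - N%:R :> R by rewrite -[N%:R]/(N%:Z%:~R) -intrN ler_int.
  by move: d1; rewrite /drift; nra.
have [v0 strip0] : exists v, strip v.
  (* The lowest site of its column with non-negative drift; rounding up adds less than [t] to the
     drift. *)
  exists (- N%:Z, Num.ceil ((1 - t) * (- N%:R) / t)).
  split => //=; rewrite /drift /=.
  have /andP[] := ceil_itv ((1 - t) * (- N%:R) / t).
  rewrite ltr_pdivlMr // ler_pdivrMr // !intrB intrN /=.
  by rewrite -[N%:Z%:~R]/(N%:R : R); set c := _%:~R; lra.
pose E := [set Lfpp W0 u x | u in strip].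
have infE : has_inf E.
  split; first by exists (Lfpp W0 v0 x), v0.
  by exists 0 => _ [u _ <-]; exact: Lfpp_ge0.
have [_ [v sv <-] vinf] := inf_adherent e0 infE.
have [v1 v2] := strip_le _ sv.
have [v' [v'1 /andP[v'2 v'x] L0v' Lv']] :=
  top_exists W_ge0 W_free W0_hor W0_ver v1 v2.
have d0 : 0 <= drift t v'.
  case: sv => /andP[d0 _] _; apply: le_trans d0 _.
  by rewrite /drift v'1 lerD2r ler_pM2l // ler_int.
have ex : exists k, drift t (bwalk h v' k) < 0 by exact: cross.
(* The step to the first site of negative drift must be downward and costs [t < 1], so the site
   before it lies in the strip. *)
case: (ex_minnP ex) => -[|k] dk kmin; first by move: dk; rewrite /bwalk /=; lra.
have dk0 : 0 <= drift t (bwalk h v' k).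
  by rewrite leNgt; apply/negP => /kmin; rewrite ltnn.
exists (bwalk h v' k).
have [b1 b2] := bwalk_le h v' k.
have su : strip (bwalk h v' k).
  split; last by case: sv => _ vN; apply: le_trans b1 _; rewrite v'1.
  rewrite dk0 /=; move: dk; rewrite bwalkS drift_back.
  by case: (h _) => /=; lra.
split; [by case: su|by case: su|].
have [f pf wf] := bwalk_free_path v' k W_free.
have := @Lfpp_triangle _ W (bwalk h v' k) f x W_ge0.
rewrite pf wf add0r v'1 => /(_ v1 v'x) Lu.
have : inf E <= Lfpp W0 (bwalk h v' k) x.
  by apply: ge_inf; [case: infE|exists (bwalk h v' k)].
lra.
Qed.

Lemma strip_sequence (x : site) : exists v : nat -> site,
  [/\ (fun m => l1 (v m) : R) @ \oo --> +oo,
      (fun m => ((v m).1)%:~R / l1 (v m) : R) @ \oo --> - t,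
      (fun m => ((v m).2)%:~R / l1 (v m) : R) @ \oo --> - (1 - t) &
      forall m, Lfpp W (v m) x <= Lfpp W0 (v m) x + harmonic m].
Proof.
have /andP[t0 t1] := t01.
have t'0 : 0 < 1 - t by lra.
(* [K] secures the condition on [x.2] in [strip_point]; in [N m], the first summand secures that on
   [x.1] and [m.+1] sends the sites to infinity. *)
pose K := Num.bound ((1 + t * `|x.2|%:~R) / (1 - t)).
have K0 : 0 <= (1 + t * `|x.2|%:~R) / (1 - t).
  apply: divr_ge0 (ltW t'0).
  by rewrite addr_ge0 // mulr_ge0 ?ler0z // ltW.
have := archi_boundP K0; rewrite -/K ltr_pdivrMr // => hK.
pose N m := (`|x.1|%N + K + m.+1)%N.
have hN m : 1 + t * `|x.2|%:~R <= (1 - t) * (N m)%:R.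
  rewrite /N !natrD; have : 0 <= `|x.1|%N%:R :> R by [].
  have : 0 <= m.+1%:R :> R by []. by nra.
have x2 : - `|x.2|%:~R <= x.2%:~R :> R by rewrite -intrN ler_int; lia.
have x20 : 0 <= `|x.2|%:~R :> R by rewrite ler0z.
have [] := choice (fun m => @strip_point x (N m) (harmonic m)
  (harmonic_gt0 m) ltac:(rewrite /N; lia) ltac:(move: (hN m); nra)).
move=> v hv; exists v.
have [] := @strip_direction v.
- by move=> m; have [] := hv m.
- by move=> m; have [_ + _] := hv m; rewrite /N; lia.
- move=> m; have [/andP[_ d1] v1 _] := hv m.
  rewrite -(lerz0 R) -(pmulr_rle0 _ t0).
  have : (v m).1%:~R <= - (N m)%:R :> R.
    by rewrite -[(N m)%:R]/((N m)%:Z%:~R) -intrN ler_int.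
  by move: d1 (hN m); rewrite /drift; nra.
by move=> c1 c2 c3; split => // m; have [] := hv m.
Qed.

(** Along a sequence adapted to [x], passing from [W0] to [W] raises the value at [x] by a vanishing
    amount at most and cannot lower that at [y], so [b <= b0]. A sequence adapted to [y] gives the
    converse. *)
Lemma busemann_eq (x y : site) (b b0 : R) :
  (forall v : nat -> site,
    (fun m => l1 (v m) : R) @ \oo --> +oo ->
    (fun m => ((v m).1)%:~R / l1 (v m) : R) @ \oo --> - t ->
    (fun m => ((v m).2)%:~R / l1 (v m) : R) @ \oo --> - (1 - t) ->
    (fun m => Lfpp W (v m) x - Lfpp W (v m) y) @ \oo --> b /\
    (fun m => Lfpp W0 (v m) x - Lfpp W0 (v m) y) @ \oo --> b0) ->
  b = b0.
Proof.
move=> lims.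
have W0_ge0 z c : 0 <= W0 z c by case: c; rewrite ?W0_hor ?W0_ver.
have W0_le z c : W0 z c <= W z c by case: c; rewrite ?W0_hor ?W0_ver.
apply/eqP; rewrite eq_le; apply/andP; split.
- have [v [v1 v2 v3 vx]] := strip_sequence x.
  have [lb lb0] := lims v v1 v2 v3.
  have lb0' : (fun m => Lfpp W0 (v m) x - Lfpp W0 (v m) y + harmonic m)
      @ \oo --> b0.
    by rewrite -[b0]addr0; exact: cvgD lb0 cvg_harmonic.
  have le m : Lfpp W (v m) x - Lfpp W (v m) y <=
      Lfpp W0 (v m) x - Lfpp W0 (v m) y + harmonic m.
    by have := vx m; have := @ler_Lfpp _ W0 W (v m) y W0_ge0 W0_le; lra.
  exact: ler_cvg_to lb lb0' (nearW _ le).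
- have [v [v1 v2 v3 vy]] := strip_sequence y.
  have [lb lb0] := lims v v1 v2 v3.
  have lb' : (fun m => Lfpp W (v m) x - Lfpp W (v m) y + harmonic m)
      @ \oo --> b.
    by rewrite -[b]addr0; exact: cvgD lb cvg_harmonic.
  have le m : Lfpp W0 (v m) x - Lfpp W0 (v m) y <=
      Lfpp W (v m) x - Lfpp W (v m) y + harmonic m.
    by have := vy m; have := @ler_Lfpp _ W0 W (v m) x W0_ge0 W0_le; lra.
  exact: ler_cvg_to lb0 lb' (nearW _ le).
Qed.

End Direction.

Lemma measure_eq_ae (d : measure_display) (T : measurableType d) (R : realType)
    (mu : {measure set T -> \bar R}) (A A' : set T) :
  measurable A -> measurable A' ->
  {ae mu, forall w, A w <-> A' w} -> mu A = mu A'.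
Proof.
move=> mA mA' [N [mN N0 sN]].
have le (C C' : set T) : measurable C -> measurable C' ->
    (forall w, C w -> ~ C' w -> N w) -> (mu C <= mu C')%E.
  move=> mC mC' CN; rewrite -[leRHS]adde0 -N0.
  apply: le_trans (measureU2 mu mC' mN); apply: le_measure; rewrite ?inE //.
    exact: measurableU.
  by move=> w Cw; have [|nC'] := pselect (C' w); [left|right; exact: CN].
apply/eqP; rewrite eq_le; apply/andP; split; apply: le => // w h1 h2;
  by apply: sN => /= -[]; tauto.
Qed.

(** * Almost sure crossing by the random free walk *)

Section SwitchWalk.
Variables (d : measure_display) (T : measurableType d) (R : realType).
Variables (P : probability T R) (alpha : R) (S : site -> T -> R).
Hypothesis alpha01 : 0 <= alpha <= 1.
Hypothesis mS : forall x, measurable_fun setT (S x).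
Hypothesis S01 : forall x w, S x w = 0 \/ S x w = 1.
Hypothesis PS1 : forall x, P [set w | S x w = 1] = alpha%:E.
Hypothesis indepS : forall (F : seq site) (A : site -> set R), uniq F ->
  (forall x, measurable (A x)) ->
  P (\bigcap_(x in [set x | x \in F]) [set w | A x (S x w)]) =
  (\prod_(x <- F) P [set w | A x (S x w)])%E.

Let horiz (w : T) (z : site) : bool := S z w == 0.

Let cyl (F : seq site) (A : site -> set R) : set T :=
  \bigcap_(x in [set x | x \in F]) [set w | A x (S x w)].

Let measurable_S x (C : set R) : measurable C ->
  measurable [set w | C (S x w)].
Proof. by move=> mC; rewrite -[X in measurable X]setTI; exact: mS. Qed.

Let PS0 x : P [set w | S x w = 0] = (1 - alpha)%:E.
Proof.
have -> : [set w | S x w = 0] = ~` [set w | S x w = 1].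
  apply/seteqP; split => w /=; first by move=> -> /esym/eqP; rewrite oner_eq0.
  by case: (S01 x w).
rewrite probability_setC; last exact: (@measurable_S x [set 1]).
by rewrite PS1.
Qed.

Let measurable_cyl F A : (forall x, measurable (A x)) -> measurable (cyl F A).
Proof.
move=> mA; apply: fin_bigcap_measurable; first exact: finite_seq.
by move=> x _; exact: measurable_S.
Qed.

(** Revealing the switch at a new site turns a cylinder event into another one, so [indepS] applies
    at every step of the walk. *)
Let cyl_cons F A z c : uniq F -> z \notin F -> (forall x, measurable (A x)) ->
  exists2 A', (forall x, measurable (A' x)) &
    cyl (z :: F) A' = [set w | S z w = c] `&` cyl F A /\
    P (cyl (z :: F) A') = (P [set w | S z w = c] * P (cyl F A))%E.
Proof.
move=> uF zF mA.
pose A' x := if x == z then [set c] else A x.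
have mA' x : measurable (A' x) by rewrite /A'; case: ifP.
have A'F x : x \in F -> A' x = A x.
  by move=> xF; rewrite /A'; case: eqP => // xz; rewrite -xz xF in zF.
exists A' => //; split; last first.
  rewrite /cyl indepS //= ?zF // big_cons {1}/A' eqxx indepS //.
  congr (_ * _)%E; rewrite big_seq [RHS]big_seq.
  by apply: eq_bigr => x xF; rewrite A'F.
apply/seteqP; split => w /=.
  move=> cw; split; first by have := cw z (mem_head z F); rewrite /A' eqxx.
  by move=> x /= xF; have := cw x; rewrite /= inE xF orbT A'F //; apply.
move=> [zc cw] x /=; rewrite inE => /orP[/eqP ->|xF].
  by rewrite /A' eqxx.
by rewrite A'F //; exact: cw.
Qed.

Let measurable_walk (Q : set site) z k :
  measurable [set w | Q (bwalk (horiz w) z k)].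
Proof.
elim: k z => [|k IH] z.
  by have [q|q] := pselect (Q z);
    [rewrite (_ : mkset _ = setT)|rewrite (_ : mkset _ = set0)] => //;
    apply/seteqP; split.
pose E := [set w | S z w = 0].
have mE : measurable E by exact: (@measurable_S z [set 0]).
rewrite (_ : mkset _ =
  (E `&` [set w | Q (bwalk (horiz w) (z.1 - 1, z.2) k)]) `|`
  (~` E `&` [set w | Q (bwalk (horiz w) (z.1, z.2 - 1) k)])).
  by apply: measurableU; apply: measurableI => //; exact: measurableC.
have walkS w : bwalk (horiz w) z k.+1 = bwalk (horiz w)
    (if S z w == 0 then (z.1 - 1, z.2) else (z.1, z.2 - 1)) k by rewrite bwalkSr.
apply/seteqP; split => w; rewrite /E /setU /setI /setC /mkset walkS.
  by case: eqP => ? ?; [left|right].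
by case=> -[]; case: eqP.
Qed.

Variable t : R.

Let stay z k := [set w | 0 <= drift t (bwalk (horiz w) z k)].

Let measurable_stay z k : measurable (stay z k).
Proof. exact: (measurable_walk (fun z => 0 <= drift t z)). Qed.

Let delta := alpha + t - 1.

(* Chebyshev's bound for the event that a walk started at [c] with [k] steps,
   each [1 - t] or [-t] with mean [- delta], ends in the positive half-line;
   the recursion over [k] conditions on the first step. *)
Let cheb (a : R) (k : nat) (c : R) : R :=
  ((c - k%:R * delta + a) ^+ 2 + k%:R * (alpha * (1 - alpha))) / a ^+ 2.

(** The cylinder records the switches already revealed; they lie on strictly higher antidiagonals,
    so the switch at [z] is independent of them. *)
Let stay_le a F A z k : 0 < a -> uniq F -> (forall x, measurable (A x)) ->
  (forall x, x \in F -> z.1 + z.2 < x.1 + x.2) ->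
  (P (cyl F A `&` stay z k) <= P (cyl F A) * (cheb a k (drift t z))%:E)%E.
Proof.
move=> a0; elim: k z F A => [|k IH] z F A uF mA zF.
  rewrite /stay /bwalk /=; have [d0|d0] := leP 0 (drift t z); last first.
    rewrite (_ : mkset _ = set0) ?setI0 ?measure0; last first.
      by apply/seteqP; split => // w /=.
    by rewrite mule_ge0 // lee_fin /cheb !mul0r addr0 divr_ge0 ?sqr_ge0.
  rewrite (_ : mkset _ = setT) ?setIT; last by apply/seteqP; split.
  rewrite -[leLHS]mule1 lee_wpmul2l // lee_fin /cheb !mul0r addr0 subr0.
  by rewrite ler_pdivlMr ?exprn_gt0 // mul1r ler_sqr ?nnegrE; lra.
have zF' : z \notin F by apply/negP => /zF; rewrite ltxx.
have [A0 mA0 [cyl0 P0]] := @cyl_cons F A z 0 uF zF' mA.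
have [A1 mA1 [cyl1 P1]] := @cyl_cons F A z 1 uF zF' mA.
have uzF : uniq (z :: F) by rewrite /= zF'.
pose zl : site := (z.1 - 1, z.2). pose zd : site := (z.1, z.2 - 1).
have levl x : x \in z :: F -> zl.1 + zl.2 < x.1 + x.2.
  by rewrite inE => /orP[/eqP ->|/zF]; rewrite /zl /=; lia.
have levd x : x \in z :: F -> zd.1 + zd.2 < x.1 + x.2.
  by rewrite inE => /orP[/eqP ->|/zF]; rewrite /zd /=; lia.
have le0 := IH zl (z :: F) A0 uzF mA0 levl.
have le1 := IH zd (z :: F) A1 uzF mA1 levd.
have dl : drift t zl = drift t z + (1 - t).
  by rewrite /drift /zl /= intrB; lra.
have dd : drift t zd = drift t z - t.
  by rewrite /drift /zd /= intrB; lra.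
apply: (@le_trans _ _ (P (cyl (z :: F) A0 `&` stay zl k) +
                       P (cyl (z :: F) A1 `&` stay zd k))%E).
  apply: le_trans (measureU2 _ _ _); last 2 first.
  - by apply: measurableI => //; exact: measurable_cyl.
  - by apply: measurableI => //; exact: measurable_cyl.
  apply: le_measure; rewrite ?inE.
  - by apply: measurableI => //; exact: measurable_cyl.
  - by apply: measurableU; apply: measurableI => //; exact: measurable_cyl.
  move=> w [cw]; rewrite /stay /mkset bwalkSr.
  rewrite (_ : back _ z = if S z w == 0 then zl else zd) // => sw.
  have [Sz|Sz] := S01 z w.
    by left; split; [rewrite cyl0|move: sw; rewrite Sz eqxx].
  by right; split; [rewrite cyl1|move: sw; rewrite Sz oner_eq0].
apply: le_trans (leeD le0 le1) _.
rewrite P0 P1 PS0 PS1 dl dd.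
have finP : P (cyl F A) \is a fin_num.
  by rewrite fin_num_measure //; exact: measurable_cyl.
rewrite -(fineK finP) -!EFinM -EFinD lee_fin.
set p := fine _.
(* [cheb a k.+1] is exactly the average of [cheb a k] over the first step. *)
rewrite le_eqVlt; apply/orP; left; apply/eqP.
rewrite /cheb /delta -[k.+1]addn1 natrD; field.
exact: lt0r_neq0.
Qed.

Hypothesis t_gt : 1 - alpha < t.

Let stay_forever z : P.-negligible (\bigcap_k stay z k).
Proof.
have mI : measurable (\bigcap_k stay z k) by exact: bigcapT_measurable.
exists (\bigcap_k stay z k); split => //.
apply/eqP; rewrite eq_le measure_ge0 andbT.
apply/lee_addgt0Pr => e e0; rewrite add0e.
have D0 : 0 < delta by have := t_gt; rewrite /delta; lra.
set c := drift t z.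
(* The first summand will give [a >= k * delta / 2], the second [4 / (k * delta ^+ 2) < e]. *)
pose K := 2 * `|c| / delta + 4 / (delta ^+ 2 * e).
have c0 : 0 <= `|c| by [].
have cc : c <= `|c| by exact: ler_norm.
have p1 : 0 <= 2 * `|c| / delta by rewrite divr_ge0 ?mulr_ge0 // ltW.
have p2 : 0 < 4 / (delta ^+ 2 * e) by rewrite divr_gt0 ?mulr_gt0 ?exprn_gt0.
have K0 : 0 <= K by rewrite addr_ge0 // ltW.
have := archi_boundP K0; set k := Num.bound K => kK.
have k1 : 2 * `|c| < k%:R * delta.
  by rewrite -ltr_pdivrMr //; move: kK; rewrite /K; lra.
have k2 : 4 < k%:R * (delta ^+ 2 * e).
  by rewrite -ltr_pdivrMr ?mulr_gt0 ?exprn_gt0 //; move: kK; rewrite /K; lra.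
have k0 : 0 < k%:R :> R by lra.
(* This choice cancels the square in [cheb] and leaves only the variance term. *)
pose a := k%:R * delta - c.
have a0 : 0 < a by rewrite /a; lra.
have := @stay_le a [::] (fun=> setT) z k a0 isT (fun=> measurableT).
rewrite /cyl (_ : \bigcap_(x in _) _ = setT); last first.
  by apply/seteqP; split => // w _ x.
rewrite setTI probability_setT mul1e => /(_ (fun=> ltac:(by []))) le.
apply: (@le_trans _ _ (P (stay z k))).
  by apply: le_measure; rewrite ?inE //; exact: bigcap_inf.
apply: (le_trans le); rewrite lee_fin /cheb -/c.
rewrite ler_pdivrMr ?exprn_gt0 //.
have -> : c - k%:R * delta + a = 0 by rewrite /a; ring.
rewrite expr0n /= add0r.
have v1 : alpha * (1 - alpha) <= 1 by move: alpha01; nra.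
have a2 : k%:R * delta / 2 <= a by rewrite /a; lra.
have a3 : (k%:R * delta / 2) ^+ 2 <= a ^+ 2.
  by rewrite ler_sqr ?nnegrE //; [rewrite divr_ge0 ?mulr_ge0 // ltW|rewrite ltW].
apply: (@le_trans _ _ (e * (k%:R * delta / 2) ^+ 2)); last first.
  by rewrite ler_pM2l.
apply: (@le_trans _ _ (k%:R * 1)); first by rewrite ler_pM2l.
have -> : e * (k%:R * delta / 2) ^+ 2 = k%:R * (k%:R * (delta ^+ 2 * e) / 4).
  by field.
by rewrite ler_pM2l //; lra.
Qed.

Lemma switch_walk_crosses :
  {ae P, forall w, forall z, exists k,
    drift t (bwalk (fun z => S z w == 0) z k) < 0}.
Proof.
have nn n : P.-negligible
    (if unpickle n is Some z then \bigcap_k stay z k else set0).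
  by case: (unpickle n) => // ; exact: negligible_set0.
apply: negligibleS (negligible_bigcup nn) => w /=.
move=> /existsNP[z nz]; exists (pickle z); [exact: I|rewrite pickleK => k _].
by rewrite /stay /= leNgt; apply/negP => lt; apply: nz; exists k.
Qed.

End SwitchWalk.

(** * Equality of the finite-dimensional distributions *)

Theorem theorem2p6 (d : measure_display) (T : measurableType d) (R : realType)
  (P : probability T R) (alpha : R)
  (S : site -> T -> R) (Wt : site -> bool -> T -> R)
  (n : nat) (t : 'I_n -> R) (B B0 : 'I_n -> site -> site -> T -> R) :
  SJR_assumptions P alpha S Wt ->
  (* directions xi_i = (t i, 1 - t i) in U with xi_1 > ... > xi_n > xi^* = (1-alpha, alpha) *)
  (forall i, 0 < t i < 1) ->
  (forall i j : 'I_n, (i < j)%N -> t j < t i) ->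
  (forall i, 1 - alpha < t i) ->
  (* B i: Busemann process of the SJR model in direction xi_i *)
  (forall i x y, measurable_fun setT (B i x y)) ->
  (forall i, IsBusemann P (fun w => Lfpp (sjr_weight S Wt w)) (t i) (B i)) ->
  (* B0 i: Busemann process of the SWFPP model (same horizontal weights, zero vertical) *)
  (forall i x y, measurable_fun setT (B0 i x y)) ->
  (forall i, IsBusemann P (fun w => Lfpp (swfpp_weight S Wt w)) (t i) (B0 i)) ->
  (* equality of all finite-dimensional distributions of the processes
     (i, x, y) |-> B i x y and (i, x, y) |-> B0 i x y *)
  forall (F : seq ('I_n * (site * site))) (A : 'I_n * (site * site) -> set R),
    (forall j, measurable (A j)) ->
    P (\bigcap_(j in [set j | j \in F]) [set w | A j (B j.1 j.2.1 j.2.2 w)]) =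
    P (\bigcap_(j in [set j | j \in F]) [set w | A j (B0 j.1 j.2.1 j.2.2 w)]).
Proof.
move=> [alpha01 [mS _] [S01 [PS1 _]] [Wt_ge0 _ _] indep] t01 _ t_gt mB BB mB0 BB0.
move=> F A mA.
have indepS (F' : seq site) (A' : site -> set R) : uniq F' ->
    (forall x, measurable (A' x)) ->
    P (\bigcap_(x in [set x | x \in F']) [set w | A' x (S x w)]) =
    (\prod_(x <- F') P [set w | A' x (S x w)])%E.
  move=> uF' mA'.
  have := indep F' A' (fun=> setT) (fun=> setT) uF'
    (fun x => And3 (mA' x) measurableT measurableT).
  rewrite (eq_bigr (fun x => P [set w | A' x (S x w)])) => [<-|x _]; last first.
    rewrite (_ : [set w | setT _ /\ _] = setT) ?probability_setT ?mule1 //.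
    by apply/seteqP; split.
  congr (P _); apply: eq_bigcapr => x _.
  by apply/seteqP; split => w //= [].
have eqB i : {ae P, forall w, forall x y, B i x y w = B0 i x y w}.
  have crossing := switch_walk_crosses alpha01 mS S01 PS1 indepS (t_gt i).
  apply: filterS3 crossing (BB i) (BB0 i) => w cross lim lim0 x y.
  (* The free edge into [z] is the one whose switching factor vanishes: horizontal if [S z w = 0],
     vertical if [S z w = 1]. *)
  refine (@busemann_eq _ (t i) (t01 i) (sjr_weight S Wt w)
    (swfpp_weight S Wt w) (fun z => S z w == 0) _ _ _ _ cross x y _ _ _).
  - move=> z b; rewrite /sjr_weight.
    by case: (S01 z w) => ->; case: b; rewrite ?subrr ?subr0 ?mul0r ?mul1r.
  - move=> z; rewrite /sjr_weight.
    by case: (S01 z w) => ->; rewrite ?eqxx ?oner_eq0 ?subrr ?mul0r.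
  - by [].
  - by [].
  - by move=> v v1 v2 v3; split; [exact: lim|exact: lim0].
have mE (D : 'I_n -> site -> site -> T -> R) :
    (forall i x y, measurable_fun setT (D i x y)) ->
    measurable (\bigcap_(j in [set j | j \in F])
      [set w | A j (D j.1 j.2.1 j.2.2 w)]).
  move=> mD; apply: fin_bigcap_measurable; first exact: finite_seq.
  by move=> j _; rewrite -[X in measurable X]setTI; exact: mD.
apply: measure_eq_ae; [exact: mE|exact: mE|].
have eqBs : {ae P, forall w, forall i x y, B i x y w = B0 i x y w}.
  exact: filter_forall eqB.
apply: filterS eqBs => w eqw.
by split=> Aw j Fj; [rewrite /= -eqw|rewrite /= eqw]; exact: Aw.
Qed.
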